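(* $\vec\chi(Forb_{ind}(\overleftrightarrow{K_2}, \overrightarrow{C_3}, \overrightarrow{K_2}+K_1))=2$, i.e. the maximum dichromatic number of a digraph with no induced digon, no induced directed triangle and no induced copy of $\overrightarrow{K_2}+K_1$ is $2$.
   Context: Digraphs have no loops and no parallel arcs, but both $xy$ and $yx$ may be arcs. The dichromatic number $\vec\chi(D)$ is the minimum number of colors in a vertex coloring of $D$ in which no color class induces a directed cycle; for a class $\mathcal C$, $\vec\chi(\mathcal C)=\sup_{D\in\mathcal C}\vec\chi(D)$. $Forb_{ind}(\mathcal F)$ is the class of digraphs containing no member of $\mathcal F$ as an induced subdigraph. $\overleftrightarrow{K_2}$ is the digon (two vertices with arcs in both directions), $\overrightarrow{C_3}$ the directed cycle of length $3$, and $\overrightarrow{K_2}+K_1$ the disjoint union of one arc and an isolated vertex. *)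

(* Defs.v *)
From mathcomp Require Import all_boot.
From mathcomp Require Import boolp.

Set Implicit Arguments.
Unset Strict Implicit.
Unset Printing Implicit Defensive.

(* Finite digraphs; [arc x y] and [arc y x] may both hold. *)
Record digraph := Digraph {
  vertex :> finType;
  arc : rel vertex;
  arc_irr : irreflexive arc
}.
Arguments arc {d}.

(* [D] has an induced subdigraph isomorphic to [H]. *)
Definition contains_induced (D H : digraph) : Prop :=
  exists2 f : H -> D, injective f & forall x y, arc (f x) (f y) = arc x y.

(* Classes are predicates rather than elements of [classical_sets.set digraph],
   which would cause a universe inconsistency. *)
Definition dclass := digraph -> Prop.

Definition Forb_ind (F : dclass) : dclass :=
  fun D => forall H, F H -> ~ contains_induced D H.

(* A directed cycle, given by the cyclic list of its vertices; length 2 is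
   allowed (a digon). *)
Definition directed_cycle (D : digraph) (s : seq D) : bool :=
  (1 < size s) && ucycleb arc s.

Definition acyclic_set (D : digraph) (X : {set D}) : Prop :=
  forall s : seq D, directed_cycle s -> ~ {subset s <= X}.

Definition dicoloring (D : digraph) (k : nat) (c : {ffun D -> 'I_k}) : Prop :=
  forall i : 'I_k, acyclic_set [set x | c x == i].

Definition dicolorable (D : digraph) (k : nat) : Prop :=
  exists c : {ffun D -> 'I_k}, dicoloring c.

Lemma dicolorable_card (D : digraph) : dicolorable D #|D|.
Proof.
exists [ffun x => enum_rank x] => i [|x [|y s]] //.
case/andP=> _ /andP[_ /= /andP[xNys _]] sub; case/negP: xNys.
have := sub x (mem_head _ _); have : y \in [:: x, y & s].
  by rewrite !inE eqxx orbT.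
move/sub; rewrite !inE !ffunE => /eqP yi /eqP xi.
by rewrite (enum_rank_inj (etrans xi (esym yi))) eqxx.
Qed.

Lemma dicolorable_ex (D : digraph) : exists k, `[< dicolorable D k >].
Proof. by exists #|D|; apply/asboolP/dicolorable_card. Qed.

Definition dichromatic_number (D : digraph) : nat := ex_minn (dicolorable_ex D).

(* [k] is the supremum of the dichromatic numbers of the members of [C]. *)
Definition dichromatic_sup (C : dclass) (k : nat) : Prop :=
  (forall D, C D -> dichromatic_number D <= k) /\
  (forall m, (forall D, C D -> dichromatic_number D <= m) -> k <= m).

Lemma digon_irr : irreflexive (fun x y : 'I_2 => x != y).
Proof. by move=> x; rewrite eqxx. Qed.
Definition digon : digraph := Digraph digon_irr.

Lemma dicycle3_irr : irreflexive (fun x y : 'I_3 => y == ordS x).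
Proof. by case=> [[|[|[]]]]. Qed.
Definition dicycle3 : digraph := Digraph dicycle3_irr.

Lemma single_arc_irr : irreflexive (fun x y : 'I_2 => x < y).
Proof. by move=> x; rewrite ltnn. Qed.
Definition single_arc : digraph := Digraph single_arc_irr.

Definition single_vertex : digraph :=
  @Digraph unit (fun _ _ => false) (fun _ => erefl).

Definition sum_arc (D E : digraph) (u v : D + E) : bool :=
  match u, v with
  | inl x, inl y => arc x y
  | inr x, inr y => arc x y
  | _, _ => false
  end.

Lemma sum_arc_irr (D E : digraph) : irreflexive (@sum_arc D E).
Proof. by case=> x; rewrite /= arc_irr. Qed.
Definition disjoint_union (D E : digraph) : digraph := Digraph (@sum_arc_irr D E).

(* Main.v *)
From mathcomp Require Import all_boot.
From mathcomp Require Import boolp.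
Require Import Defs.

(** The digraphs of the class are the orientations of complete multipartite
graphs without directed triangle, and in such a digraph no strong component
meets three parts. Indeed, a shortest closed walk through three parts has
consecutive vertices [a -> b -> c] in distinct parts. As there is no directed
triangle, [a -> c], so that the walk can skip [b] and, by minimality, then stays
in the parts of [a] and [c]; hence [b] is adjacent to all of it. Starting from
[b -> c], absence of directed triangles propagates along the walk that [b]
dominates each of its vertices, up to [a]: this contradicts [a -> b]. Coloring
each vertex according to whether it lies in the part of a fixed representative
of its strong component therefore leaves no directed cycle monochromatic. The
directed 4-cycle attains the bound. *)

Set Implicit Arguments.
Unset Strict Implicit.
Unset Printing Implicit Defensive.

Section StrongConnectivity.

Variables (T : finType) (e : rel T).

Definition strongly_connected (x y : T) : bool :=
  connect e x y && connect e y x.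

Definition strong_root (x : T) : T := choose (strongly_connected x) x.

Lemma strongly_connected_root (x : T) : strongly_connected x (strong_root x).
Proof. by apply: chooseP; rewrite /strongly_connected connect0. Qed.

Lemma strong_root_eq (x y : T) :
  strongly_connected x y -> strong_root x = strong_root y.
Proof.
move=> sxy; have /andP[xy yx] := sxy.
have -> : strong_root y = choose (strongly_connected x) y.
  apply: eq_choose => z; apply/andP/andP=> -[].
    by move=> /(connect_trans xy) xz zy; split=> //; apply: connect_trans yx.
  by move=> /(connect_trans yx) yz zx; split=> //; apply: connect_trans xy.
by apply: choose_id; rewrite // /strongly_connected connect0.
Qed.

Lemma arc_on_closed_walk (x y z : T) :
  e x y -> connect e y z -> connect e z x -> z != x -> z != y ->
  exists2 s, cycle e [:: x, y & s] & z \in s.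
Proof.
move=> xy /connectP[p yp zE] /connectP[q zq xE] zx zy.
case/lastP: q => [|q x'] in zq xE; first by rewrite xE eqxx in zx.
rewrite last_rcons in xE; rewrite -{x'}xE in zq.
exists (p ++ q); first by rewrite /= xy rcons_cat cat_path yp -zE.
by have := mem_last y p; rewrite -zE inE (negbTE zy) mem_cat => /= ->.
Qed.

End StrongConnectivity.

Section ForbiddenSubdigraphs.

Variable D : digraph.
Implicit Types x y z : D.

Definition adjacent x y : bool := arc x y || arc y x.

Definition digon_free : Prop := forall x y, arc x y -> ~~ arc y x.

Definition dicycle3_free : Prop :=
  forall x y z, arc x y -> arc y z -> ~~ arc z x.

Definition complete_multipartite : Prop :=
  transitive (fun x y => ~~ adjacent x y).

Lemma adjacentC x y : adjacent x y = adjacent y x.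
Proof. exact: orbC. Qed.

Lemma adjacent_irr : irreflexive adjacent.
Proof. by move=> x; rewrite /adjacent arc_irr. Qed.

Lemma arc_adjacent x y : arc x y -> adjacent x y.
Proof. by rewrite /adjacent => ->. Qed.

Lemma adjacent_neq x y : adjacent x y -> x != y.
Proof. by apply: contraTneq => ->; rewrite adjacent_irr. Qed.

Lemma digon_freeP : ~ contains_induced D digon <-> digon_free.
Proof.
split=> [noD x y xy | free [f _ fE]]; last first.
  have /free : arc (f ord0) (f ord_max) by rewrite fE.
  by rewrite fE.
apply/negP => yx; apply: noD; exists (tnth [tuple x; y]).
  by apply/tuple_uniqP; rewrite /= inE (adjacent_neq (arc_adjacent xy)).
by case=> [[|[|//]]] ? [[|[|//]]] ?; rewrite !(tnth_nth x) /= ?arc_irr.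
Qed.

Lemma dicycle3_freeP :
  digon_free -> ~ contains_induced D dicycle3 <-> dicycle3_free.
Proof.
move=> oriented; split=> [noC x y z xy yz | free [f _ fE]]; last first.
  pose i (k : nat) : dicycle3 := inord k.
  have := free (f (i 0)) (f (i 1)) (f (i 2)).
  by rewrite !fE /= -!val_eqE /= !inordK // => /(_ isT isT).
apply/negP => zx; apply: noC; exists (tnth [tuple x; y; z]).
  apply/tuple_uniqP; rewrite /= !inE (eq_sym x z) !negb_or.
  by rewrite !(adjacent_neq (arc_adjacent _)).
have [yx zy xz] := And3 (oriented _ _ xy) (oriented _ _ yz) (oriented _ _ zx).
case=> [[|[|[|//]]]] ? [[|[|[|//]]]] ?; rewrite !(tnth_nth x) /=;
  by rewrite ?arc_irr // ?xy ?yz ?zx ?(negbTE yx) ?(negbTE zy) ?(negbTE xz).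
Qed.

Lemma contains_arc_plus_vertex x y z :
    arc x y -> ~~ arc y x -> ~~ adjacent x z -> ~~ adjacent y z ->
  contains_induced D (disjoint_union single_arc single_vertex).
Proof.
move=> xy nyx nxz nyz.
exists (fun u : disjoint_union single_arc single_vertex =>
  if u is inl i then tnth [tuple x; y] i else z).
  have arc_neq_z i : tnth [tuple x; y] i != z.
    case: i => [[|[|//]]] ?; rewrite (tnth_nth x) /=.
      by apply: contraNneq nyz => <-; rewrite adjacentC arc_adjacent.
    by apply: contraNneq nxz => <-; rewrite arc_adjacent.
  have arc_inj : injective (tnth [tuple x; y]).
    by apply/tuple_uniqP; rewrite /= inE (adjacent_neq (arc_adjacent xy)).
  case=> [i|[]] [j|[]] // /eqP; first by move/eqP/arc_inj->.
    by rewrite (negbTE (arc_neq_z i)).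
  by rewrite eq_sym (negbTE (arc_neq_z j)).
move: nyx nxz nyz => /negbTE yx /norP[/negbTE xz /negbTE zx].
move=> /norP[/negbTE yz /negbTE zy].
by case=> [[[|[|//]] ?]|[]] [[[|[|//]] ?]|[]];
  rewrite ?(tnth_nth x) /= ?arc_irr.
Qed.

Lemma complete_multipartiteP :
  digon_free ->
  ~ contains_induced D (disjoint_union single_arc single_vertex) <->
  complete_multipartite.
Proof.
move=> oriented; split=> [noK | multi [f _ fE]]; last first.
  pose x : disjoint_union single_arc single_vertex := inl ord0.
  pose y : disjoint_union single_arc single_vertex := inl ord_max.
  pose z : disjoint_union single_arc single_vertex := inr tt.
  by have := multi (f z) (f x) (f y); rewrite /adjacent !fE => /(_ isT isT).
have arc_covers x y z : arc x y -> ~~ adjacent x z -> adjacent y z.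
  move=> xy nxz; apply/negPn/negP => nyz.
  by apply: noK; apply: contains_arc_plus_vertex xy (oriented _ _ xy) nxz nyz.
move=> z x y nxz; rewrite adjacentC => nyz.
apply/norP; split; apply/negP => joined.
  by case/negP: nyz; apply: arc_covers joined nxz.
by case/negP: nxz; apply: arc_covers joined nyz.
Qed.

End ForbiddenSubdigraphs.

Section OrientedMultipartite.

Variable D : digraph.
Hypothesis D_digon_free : digon_free D.
Hypothesis D_dicycle3_free : dicycle3_free D.
Hypothesis D_multipartite : complete_multipartite D.
Implicit Types (x y z : D) (s : seq D).

Lemma adjacent_or z x y : adjacent x y -> adjacent x z || adjacent z y.
Proof. by apply: contraLR => /norP[]; apply: D_multipartite. Qed.

Lemma arc_trans_adjacent x y z : arc x y -> arc y z -> adjacent x z -> arc x z.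
Proof. by move=> xy yz /orP[//|zx]; case/negP: (D_dicycle3_free xy yz). Qed.

Lemma arc_last_adjacent x y s :
  arc x y -> path arc y s -> {in s, forall z, adjacent x z} -> arc x (last y s).
Proof.
elim: s => [|z s IH] //= in y *; move=> xy /andP[yz zs] adj_s.
apply: IH zs _ => [|u us]; last by rewrite adj_s // inE us orbT.
by apply: arc_trans_adjacent yz _; rewrite // adj_s ?mem_head.
Qed.

Lemma infix_adjacent x y z s :
    z \in s -> adjacent x z -> adjacent y z ->
  exists a b c, infix [:: a; b; c] [:: x, y & s] /\ adjacent a c.
Proof.
elim: s => [|u s IH] //= in x y *; move=> zs xz yz.
have [xu|nxu] := boolP (adjacent x u).
  by exists x, y, u; rewrite !eqxx prefix0s.
have uz : adjacent u z by move: (adjacent_or u xz); rewrite (negbTE nxu).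
move: zs; rewrite inE => /predU1P[zu|zs]; first by rewrite -zu xz in nxu.
have [a [b [c [abc ac]]]] := IH _ _ zs yz uz.
by exists a, b, c; split=> //; apply: infix_trans abc (infix_cons _ _).
Qed.

Lemma cycle_triangle_free x y z s :
  cycle arc [:: x, y & s] -> z \in s -> adjacent x z -> ~~ adjacent y z.
Proof.
have [n] := ubnP (size s); elim: n => // n IH in x y z s *.
rewrite ltnS => size_s walk zs xz; apply/negP => yz.
have [a [b [c [/infixP[p [q sE]] ac]]]] := infix_adjacent zs xz yz.
have size_qp : size (q ++ p) < n.
  apply: leq_trans size_s; have := congr1 size sE.
  by rewrite /= !size_cat !addnS addnC => -[->].
move: walk; rewrite sE -(rot_cycle (size p)) rot_size_cat -catA.
case/and3P=> ab bc c_qp_a; have ac_arc := arc_trans_adjacent ab bc ac.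
have shortcut : cycle arc [:: a, c & q ++ p] by rewrite /= ac_arc.
have b_adjacent u : u \in rcons (q ++ p) a -> adjacent b u.
  rewrite mem_rcons inE => /predU1P[->|u_qp].
    by rewrite adjacentC arc_adjacent.
  apply/negPn/negP => /negbTE nbu.
  have := adjacent_or u (arc_adjacent bc).
  have := adjacent_or u (arc_adjacent ab).
  rewrite !(adjacentC u) nbu orbF /= => au.
  exact/negP/(IH _ _ _ _ size_qp shortcut).
have := arc_last_adjacent bc c_qp_a b_adjacent.
by rewrite last_rcons; apply/negP/D_digon_free.
Qed.

Lemma strongly_connected_triangle_free x y z :
  strongly_connected arc x y -> strongly_connected arc x z ->
  arc x y -> adjacent x z -> ~~ adjacent y z.
Proof.
move=> /andP[_ yx] /andP[xz zx] xy adj_xz; apply/negP => adj_yz.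
have [||s walk zs] := arc_on_closed_walk xy (connect_trans yx xz) zx.
- by rewrite eq_sym adjacent_neq.
- by rewrite eq_sym adjacent_neq.
by have := cycle_triangle_free walk zs adj_xz; rewrite adj_yz.
Qed.

Lemma dicolorable2 : dicolorable D 2.
Proof.
pose in_root_part x := ~~ adjacent x (strong_root arc x).
exists [ffun x => if in_root_part x then ord0 else ord_max].
move=> i [|x [|y s]] // /andP[_ /andP[walk _]] mono.
have xs : x \in [:: x, y & s] by rewrite mem_head.
have ys : y \in [:: x, y & s] by rewrite !inE eqxx orbT.
have sxy : strongly_connected arc x y.
  by rewrite /strongly_connected !(connect_cycle walk).
have xy : arc x y by case/andP: walk.
have same_color : in_root_part x = in_root_part y.
  move: (mono x xs) (mono y ys); rewrite !inE !ffunE => /eqP<- /eqP.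
  by case: (in_root_part x); case: (in_root_part y).
have := strongly_connected_triangle_free sxy (strongly_connected_root _ _) xy.
have := adjacent_or (strong_root arc x) (arc_adjacent xy).
move: same_color; rewrite /in_root_part -(strong_root_eq sxy) => /negb_inj adjE.
by rewrite (adjacentC _ y) adjE orbb => -> /(_ isT).
Qed.

End OrientedMultipartite.

Lemma dichromatic_number_le (D : digraph) (k : nat) :
  dicolorable D k -> dichromatic_number D <= k.
Proof.
rewrite /dichromatic_number; case: ex_minnP => m _ min_m Dk.
exact/min_m/asboolP.
Qed.

Lemma dichromatic_number_gt1 (D : digraph) (s : seq D) :
  directed_cycle s -> 1 < dichromatic_number D.
Proof.
rewrite /dichromatic_number; case: ex_minnP => m /asboolP[col colP] _ cyc.
case: m col colP => [|[|//]] col colP.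
  by case: s cyc => // x s _; case: (col x).
by case: (colP ord0 s cyc) => x _; rewrite inE ord1.
Qed.

Lemma Forb_ind_oriented_multipartite (D : digraph) :
  Forb_ind (fun H : digraph =>
    [\/ H = digon,
        H = dicycle3
      | H = disjoint_union single_arc single_vertex]) D <->
  [/\ digon_free D, dicycle3_free D & complete_multipartite D].
Proof.
split=> [forb | [oriented noC multi] H].
  have oriented : digon_free D by apply/digon_freeP/forb; constructor 1.
  split=> //; first by apply/(dicycle3_freeP oriented)/forb; constructor 2.
  by apply/(complete_multipartiteP oriented)/forb; constructor 3.
case=> ->; first exact/digon_freeP.
  exact/(dicycle3_freeP oriented).
exact/(complete_multipartiteP oriented).
Qed.

Lemma dicycle4_irr : irreflexive (fun x y : 'I_4 => y == ordS x).
Proof. by case=> [[|[|[|[|//]]]]]. Qed.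

Definition dicycle4 : digraph := Digraph dicycle4_irr.

Lemma directed_cycle_dicycle4 :
  directed_cycle (D := dicycle4) (traject (@ordS 4) ord0 4).
Proof. by []. Qed.

Lemma dicycle4_digon_free : digon_free dicycle4.
Proof. by move=> x _ /eqP->; case: x => [[|[|[|[|//]]]]]. Qed.

Lemma dicycle4_dicycle3_free : dicycle3_free dicycle4.
Proof. by move=> x _ _ /eqP-> /eqP->; case: x => [[|[|[|[|//]]]]]. Qed.

Lemma dicycle4_complete_multipartite : complete_multipartite dicycle4.
Proof. by do 3!case=> [[|[|[|[|//]]]] ?]. Qed.

Theorem theorem9 :
  dichromatic_sup
    (Forb_ind (fun H : digraph =>
       [\/ H = digon,
            H = dicycle3
          | H = disjoint_union single_arc single_vertex]))
    2.
Proof.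
split=> [D /Forb_ind_oriented_multipartite[oriented noC multi] | m bound].
  exact/dichromatic_number_le/dicolorable2.
apply: leq_trans (dichromatic_number_gt1 directed_cycle_dicycle4) (bound _ _).
apply/Forb_ind_oriented_multipartite; split.
- exact: dicycle4_digon_free.
- exact: dicycle4_dicycle3_free.
- exact: dicycle4_complete_multipartite.
Qed.
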